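(* Let $(P_\alpha)_{\alpha\in A}$ be a net of probability measures on $(\mathcal{F},\mathcal{B}_F)$ and let $P$ be a probability measure on $(\mathcal{F},\mathcal{B}_F)$. The following statements (i)-(iii) are equivalent: (i) $P_\alpha \rightarrow_w P$ on $(\mathcal{F},\tau_{uF})$. (ii) $$\limsup_\alpha P_\alpha\Big(\bigcap_{i=1}^m \mathcal{H}(K_i)\Big) \le P\Big(\bigcap_{i=1}^m \mathcal{H}(K_i)\Big)$$ for every $m \in \mathbb{N}$ and every finite collection $K_1,\ldots,K_m$ of non-empty compact sets in $E$. (iii) The inequality $\limsup_\alpha P_\alpha(\bigcap_{i=1}^m \mathcal{H}(K_i)) \le P(\bigcap_{i=1}^m \mathcal{H}(K_i))$ holds for every $m \in \mathbb{N}$ and every finite collection $K_1,\ldots,K_m$ of non-empty compact sets in $E$ such that $P(\partial_F \mathcal{H}(K_i))=0$ for all $1 \le i \le m$.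
   Context: $(E,\mathcal{G})$ is a non-empty locally compact, second-countable Hausdorff space; $\mathcal{G}$ is the family of its open sets, and $\mathcal{F}$ and $\mathcal{K}$ are the families of all closed and all compact subsets of $E$. For $A\subseteq E$ put $\mathcal{M}(A)=\{F\in\mathcal{F}: F\cap A=\emptyset\}$ and $\mathcal{H}(A)=\{F\in\mathcal{F}: F\cap A\neq\emptyset\}$. The Fell topology $\tau_F$ on $\mathcal{F}$ is generated by $\{\mathcal{M}(K):K\in\mathcal{K}\}\cup\{\mathcal{H}(G):G\in\mathcal{G}\}$; the upper Fell topology $\tau_{uF}$ on $\mathcal{F}$ is generated by $\{\mathcal{M}(K):K\in\mathcal{K}\}$. Their Borel $\sigma$-algebras coincide: $\mathcal{B}_F:=\sigma(\tau_F)=\sigma(\tau_{uF})$. For $\mathbf{A}\subseteq\mathcal{F}$, $\partial_F\mathbf{A}$ denotes the boundary of $\mathbf{A}$ with respect to $\tau_F$. Weak convergence: for a topological space $(X,\mathcal{O})$ and a net $(P_\alpha)_{\alpha\in A}$ ($A$ a directed set) of probability measures and a probability measure $P$ on $(X,\sigma(\mathcal{O}))$, $P_\alpha\rightarrow_w P$ on $(X,\mathcal{O})$ means convergence in the weak topology, i.e. the initial topology on the set of probability measures with respect to the maps $P\mapsto P(O)$, $O\in\mathcal{O}$, into $\mathbb{R}$ with the topology $\{(a,\infty):a\in\mathbb{R}\}\cup\{\emptyset,\mathbb{R}\}$. Equivalently: $\liminf_\alpha P_\alpha(O)\ge P(O)$ for all $O\in\mathcal{O}$; equivalently: $\limsup_\alpha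 P_\alpha(F)\le P(F)$ for all closed sets $F$ of $(X,\mathcal{O})$. *)

(* Defs.v *)
From HB Require Import structures.
From mathcomp Require Import all_boot all_order all_algebra.
From mathcomp Require Import all_classical all_reals all_analysis.

Set Implicit Arguments.
Unset Strict Implicit.
Unset Printing Implicit Defensive.

Import Order.TTheory GRing.Theory Num.Theory.
Local Open Scope classical_set_scope.
Local Open Scope ring_scope.

Definition closed_sets (E : topologicalType) : Type :=
  set_type [set F : set E | closed F].

HB.instance Definition _ (E : topologicalType) := Choice.on (closed_sets E).

(* A base point is only needed because [g_sigma_algebraType] asks for one. *)
Definition empty_closed (E : topologicalType) : closed_sets E :=
  exist _ (set0 : set E) (mem_set closed0).

HB.instance Definition _ (E : topologicalType) :=
  isPointed.Build (closed_sets E) (empty_closed E).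

Definition missing (E : topologicalType) (A : set E) : set (closed_sets E) :=
  [set F | val F `&` A = set0].

Definition hitting (E : topologicalType) (A : set E) : set (closed_sets E) :=
  [set F | val F `&` A !=set0].

Definition upper_fell_subbase (E : topologicalType) : set_system (closed_sets E) :=
  [set missing K | K in compact].

Definition fell_subbase (E : topologicalType) : set_system (closed_sets E) :=
  [set missing K | K in compact] `|` [set hitting G | G in open].

(* [fell E] and [upper_fell E] are copies of the same carrier; the copy selects
   the topology. *)
Definition fell (E : topologicalType) : Type := closed_sets E.
HB.instance Definition _ (E : topologicalType) := Pointed.on (fell E).
HB.instance Definition _ (E : topologicalType) :=
  isSubBaseTopological.Build (fell E) (@fell_subbase E) id.

Definition upper_fell (E : topologicalType) : Type := closed_sets E.
HB.instance Definition _ (E : topologicalType) := Pointed.on (upper_fell E).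
HB.instance Definition _ (E : topologicalType) :=
  isSubBaseTopological.Build (upper_fell E) (@upper_fell_subbase E) id.

Definition fell_open (E : topologicalType) : set_system (closed_sets E) :=
  @open (fell E).

Definition upper_fell_open (E : topologicalType) : set_system (closed_sets E) :=
  @open (upper_fell E).

Notation borel_fell E := (g_sigma_algebraType (@fell_open E)).

Definition boundary (X : topologicalType) (A : set X) : set X :=
  closure A `\` interior A.

Definition fell_boundary (E : topologicalType) (A : set (closed_sets E)) :
    set (closed_sets E) :=
  @boundary (fell E) A.

(* The real numbers with the topology whose open sets are the rays ]a, +oo[,
   the empty set and the whole line. *)
Definition lower_reals (R : realType) : Type := R.
HB.instance Definition _ (R : realType) := Choice.on (lower_reals R).

Section lower_reals_topology.
Variable R : realType.

Definition lower_open : set_system (lower_reals R) :=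
  [set U | [\/ U = setT, U = set0 | exists a : R, U = [set x : R | a < x]]].

Let lower_openT : lower_open setT. Proof. by apply: Or31. Qed.

Let lower_openI : setI_closed lower_open.
Proof.
move=> U V [->|->|[a ->]].
- by rewrite setTI.
- by rewrite set0I => _; apply: Or32.
- move=> [->|->|[b ->]].
  + by rewrite setIT; apply: Or33; exists a.
  + by rewrite setI0; apply: Or32.
  + apply: Or33; exists (Num.max a b); apply/seteqP; split => x /=.
      by rewrite gt_max => -[-> ->].
    by rewrite gt_max => /andP[].
Qed.

Let lower_open_bigU (I : Type) (f : I -> set (lower_reals R)) :
  (forall i, lower_open (f i)) -> lower_open (\bigcup_i f i).
Proof.
move=> fo; set U := \bigcup_i f i.
have up (x y : R) : U x -> x < y -> U y.
  move=> [i _ fx] xy; exists i => //.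
  case: (fo i) => [e|e|[a e]]; move: fx; rewrite e //=.
  by move=> ax; exact: lt_trans ax xy.
have [->|/set0P[x0 Ux0]] := eqVneq U set0; first by apply: Or32.
have [lbU|nlbU] := pselect (has_lbound (U : set R)); last first.
  apply: Or31; apply/seteqP; split => // y _.
  apply: contrapT => nUy; apply: nlbU; exists y => x Ux.
  by rewrite leNgt; apply/negP => xy; apply: nUy; exact: up Ux xy.
apply: Or33; exists (inf (U : set R)); apply/seteqP; split => y /=.
  move=> [i _ fy].
  case: (fo i) => [e|e|[a e]]; move: (fy); rewrite e //=.
    have [b bU] := lbU; have := bU (b - 1).
    have Ub : U (b - 1) by exists i; rewrite // e.
    by move=> /(_ Ub); rewrite lerBrDl gerDr ler10.
  move=> ay; have [z /andP[az zy]] : exists z : R, a < z < y.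
    by exists ((a + y) / 2); rewrite !midf_lt.
  apply: le_lt_trans zy; apply: ge_inf => //.
  by exists i => //; rewrite e.
move=> /inf_lt[|x Ux xy]; first by exists x0.
exact: up Ux xy.
Qed.

HB.instance Definition _ := isOpenTopological.Build (lower_reals R)
  lower_openT lower_openI lower_open_bigU.

End lower_reals_topology.

Definition eval_open d (T : measurableType d) (R : realType)
    (U : set T) (P : probability T R) : lower_reals R := fine (P U).

(* For a topology O on T, the probability measures on T with the initial
   topology for the evaluations P |-> P(U), U in O. The sigma-algebra of T is
   meant to be generated by O; O is a parameter because several topologies may
   generate the same sigma-algebra, as the Fell and upper Fell topologies do
   when E is locally compact, Hausdorff and second-countable. *)
Definition weak_probability d (T : measurableType d) (R : realType)
    (O : set_system T) : Type :=
  sup_topology (fun U : {U : set T | O U} =>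
    Topological.on (initial_topology (@eval_open d T R (sval U)))).

HB.instance Definition _ d (T : measurableType d) (R : realType)
  (O : set_system T) := Topological.on (@weak_probability d T R O).

Definition directed (A : Type) (le : A -> A -> Prop) : Prop :=
  [/\ inhabited A, (forall a, le a a),
      (forall a b c, le a b -> le b c -> le a c) &
      (forall a b, exists c, le a c /\ le b c)].

Definition tails (A : Type) (le : A -> A -> Prop) : set_system A :=
  filter_from [set: A] (fun a => [set b | le a b]).

Definition net_limsup (R : realType) (A : Type) (le : A -> A -> Prop)
    (x : A -> \bar R) : \bar R :=
  ereal_inf [set ereal_sup [set x b | b in [set b | le a b]] | a in [set: A]].

Definition weak_cvg d (T : measurableType d) (R : realType)
    (A : Type) (le : A -> A -> Prop) (P_ : A -> probability T R)
    (P : probability T R) (O : set_system T) : Prop :=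
  (P_ : A -> weak_probability R O) @ tails le --> (P : weak_probability R O).

(* Main.v *)
Require Import Defs.
From HB Require Import structures.
From mathcomp Require Import all_boot all_order all_algebra finmap.
From mathcomp Require Import all_classical all_reals all_analysis.
From mathcomp Require Import lra.

(** The upper Fell topology has the sets [missing K], [K] compact, as a base.
    Convergence in the weak topology for it means
    [P U <= liminf_a P_ a U] for every open [U].

    Finite intersections of sets [hitting K], [K] compact, are complements of
    open sets, so weak convergence gives the inequalities for the limsup by
    passing to complements; and these for all compact sets give a fortiori
    those for the compact sets whose hitting set has a [P]-null boundary.

    The converse rests on the supply of such compact sets. The Fell boundary of
    [hitting K] lies in the rim [hitting K `\` hitting K°]. Local compactness
    gives, around each point, Urysohn functions [f] whose sublevel sets
    [f <= t], [t < 1], are compact; the function [t |-> P (hitting [f < t])] is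
    nondecreasing, and at each of its continuity points [t] in [`]0, 1[] the
    set [f <= t] has a null rim ([null_rim_sublevel], [null_rim_nbhs]). Null
    rims are preserved by finite unions, and a countable base of [E] allows one
    to select countably many compact sets with null rims whose interiors form a
    base ([null_rim_countable_basis]). Covering compact sets by finite unions of
    these, every upper Fell open set [U] other than [set0] and [setT] is a
    countable union of sets [missing (K n)] where each [K n] is non-empty,
    compact and has a null rim ([upper_fell_open_null_rim]). By continuity of
    [P] from below, a finite subunion [V] of it has almost the measure of [U];
    its complement is a finite intersection of sets [hitting (K n)], and the
    inequality for that intersection yields the one for [V], hence for [U]. *)

Set Implicit Arguments.
Unset Strict Implicit.
Unset Printing Implicit Defensive.

Import Order.TTheory GRing.Theory Num.Theory.
Import numFieldNormedType.Exports.
Local Open Scope classical_set_scope.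
Local Open Scope ereal_scope.

(** * Hitting and missing sets, and the two topologies *)

Lemma setC_hitting (E : topologicalType) (A : set E) :
  ~` hitting A = missing A.
Proof.
apply/seteqP; split => F /=; first by move=> /set0P/negP; rewrite negbK => /eqP.
by rewrite /missing /hitting /= => -> /set0P; rewrite eqxx.
Qed.

Lemma setC_missing (E : topologicalType) (A : set E) :
  ~` missing A = hitting A.
Proof. by rewrite -setC_hitting setCK. Qed.

Lemma hittingS (E : topologicalType) (A B : set E) :
  A `<=` B -> hitting A `<=` hitting B.
Proof. by move=> AB F [x [Fx /AB Bx]]; exists x. Qed.

Lemma missingS (E : topologicalType) (A B : set E) :
  A `<=` B -> missing B `<=` missing A.
Proof. by move=> /hittingS; rewrite -!setC_hitting; exact: subsetC. Qed.

Lemma hitting_bigcup (E : topologicalType) (I : Type) (D : set I)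
    (A : I -> set E) :
  hitting (\bigcup_(i in D) A i) = \bigcup_(i in D) hitting (A i).
Proof.
apply/seteqP; split => F.
  by move=> [x [Fx [i Di Aix]]]; exists i => //; exists x.
by move=> [i Di [x [Fx Aix]]]; exists x; split => //; exists i.
Qed.

Lemma hittingU (E : topologicalType) (A B : set E) :
  hitting (A `|` B) = hitting A `|` hitting B.
Proof.
apply/seteqP; split => F.
  by move=> [x [Fx [Ax|Bx]]]; [left|right]; exists x.
by move=> [[x [Fx Ax]]|[x [Fx Bx]]]; exists x; split => //; [left|right].
Qed.

Lemma upper_fell_open_missing (E : topologicalType) (K : set E) :
  compact K -> upper_fell_open (missing K).
Proof.
move=> cK; exists [set missing K]; last by rewrite bigcup_set1.
move=> _ ->; exists [fset missing K]%fset.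
  by move=> A /fset1P ->; apply: mem_set; exists K.
by rewrite set_fset1 bigcap_set1.
Qed.

Lemma fell_open_missing (E : topologicalType) (K : set E) :
  compact K -> fell_open (missing K).
Proof.
move=> cK; exists [set missing K]; last by rewrite bigcup_set1.
move=> _ ->; exists [fset missing K]%fset.
  by move=> A /fset1P ->; apply: mem_set; left; exists K.
by rewrite set_fset1 bigcap_set1.
Qed.

Lemma fell_open_hitting (E : topologicalType) (G : set E) :
  open G -> fell_open (hitting G).
Proof.
move=> oG; exists [set hitting G]; last by rewrite bigcup_set1.
move=> _ ->; exists [fset hitting G]%fset.
  by move=> A /fset1P ->; apply: mem_set; right; exists G.
by rewrite set_fset1 bigcap_set1.
Qed.

(** The sets [missing K], [K] compact, form a base of the upper Fell topology
    and not only a subbase, because they are stable under finite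
    intersections. *)
Lemma upper_fell_open_base (E : topologicalType) (U : set (closed_sets E)) F :
  upper_fell_open U -> U F ->
  exists K, [/\ compact K, missing K F & missing K `<=` U].
Proof.
move=> [B sB <-] [C BC CF]; have [D sD eC] := sB _ BC.
suff [K [cK KF KC]] : exists K, [/\ compact K, missing K F & missing K `<=` C].
  by exists K; split => // G /KC CG; exists C.
move: CF; rewrite -eC => {B C sB BC eC}.
elim/finSet_rect: D sD => D IH sD DF.
have [->|/fset0Pn[X XD]] := eqVneq D fset0.
  exists set0; split; first exact: compact0.
    by rewrite /missing /= setI0.
  by move=> G _ /= Y.
have [|||K [cK KF KD]] := IH (D `\ X)%fset.
- exact: fproperD1.
- by move=> Y /fsetD1P[_ YD]; exact: sD.
- by move=> Y /fsetD1P[_ YD]; exact: DF.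
have := sD _ XD; rewrite inE => -[L cL LX].
exists (L `|` K); split; first exact: compactU.
  rewrite /missing /= setIUr (KF : _ = _) setU0.
  by have := DF _ XD; rewrite /= -LX.
move=> G GLK Y /= YD; have [->|YX] := eqVneq Y X.
  by rewrite -LX; apply: missingS GLK; exact: subsetUl.
by apply: (KD G); [apply: missingS GLK; exact: subsetUr|apply/fsetD1P].
Qed.

Lemma upper_fell_open_fell (E : topologicalType) :
  @upper_fell_open E `<=` @fell_open E.
Proof.
move=> U oU.
rewrite (_ : U = \bigcup_(K in [set K | compact K /\ missing K `<=` U])
  missing K); last first.
  apply/seteqP; split => F; last by move=> [K [_ KU] KF]; exact: KU.
  by move=> /(upper_fell_open_base oU)[K [cK KF KU]]; exists K.
by apply: (@bigcup_open (fell E)) => K [cK _]; exact: fell_open_missing.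
Qed.

(** The set [hitting K] is closed, and it contains the open set
    [hitting (interior K)]. *)
Lemma fell_boundary_hitting (E : topologicalType) (K : set E) : compact K ->
  fell_boundary (hitting K) `<=` hitting K `\` hitting (interior K).
Proof.
move=> cK; apply: setDSS.
  have /closure_id <- // : @closed (fell E) (hitting K).
  by rewrite -openC setC_hitting; exact: fell_open_missing.
have oH : @open (fell E) (hitting (interior K)).
  by apply: fell_open_hitting; exact: open_interior.
have : hitting (interior K) `<=` hitting K.
  by apply: hittingS; exact: interior_subset.
by rewrite (@open_subsetE (fell E) _ _ oH).
Qed.

Section borel.
Variable E : topologicalType.
Implicit Types (K G : set E) (U : set (borel_fell E)).

Lemma measurable_fell_open U : fell_open U -> measurable U.
Proof. exact: sub_gen_smallest. Qed.

Lemma measurable_upper_fell_open U : upper_fell_open U -> measurable U.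
Proof. by move=> /upper_fell_open_fell; exact: measurable_fell_open. Qed.

Lemma measurable_missing K :
  compact K -> measurable (missing K : set (borel_fell E)).
Proof. by move=> /fell_open_missing; exact: measurable_fell_open. Qed.

Lemma measurable_hitting K :
  compact K -> measurable (hitting K : set (borel_fell E)).
Proof.
move=> cK; rewrite -setC_missing; apply: (@measurableC _ (borel_fell E)).
exact: measurable_missing.
Qed.

Lemma measurable_hitting_open G :
  open G -> measurable (hitting G : set (borel_fell E)).
Proof. by move=> /fell_open_hitting; exact: measurable_fell_open. Qed.

Lemma measurable_fell_boundary U :
  measurable (fell_boundary U : set (borel_fell E)).
Proof.
apply: (@measurableD _ (borel_fell E)).
  rewrite -[closure _]setCK; apply: (@measurableC _ (borel_fell E)).
  apply: measurable_fell_open.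
  by rewrite /fell_open openC; exact: closed_closure.
by apply: measurable_fell_open; exact: open_interior.
Qed.

End borel.

(** * Compact sets with a null rim *)

(** A nondecreasing function has countably many discontinuities, whereas
    [`]0, 1[] is uncountable; only right-continuity is recorded. *)
Lemma nondecreasing_continuity_point (R : realType) (g : R -> R) :
  {homo g : s t / (s <= t)%R} ->
  exists2 t : R, (0 < t < 1)%R &
    forall e : R, (0 < e)%R -> exists2 s, (t < s)%R & (g s < g t + e)%R.
Proof.
move=> ndg.
have /existsNP[t /not_implyP[t01 ncont]] :
    ~ (`]0%R, 1%R[%classic `<=`
       [set t : R | t \in `]0, 1[%R /\ discontinuity g t]).
  move=> /subset_card_le /sub_countable cnt.
  have nd01 : {in `[0, 1]%R &, nondecreasing_fun g}.
    by move=> x y _ _; exact: ndg.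
  have /countable_lebesgue_measure0 := cnt (discontinuity_countable nd01).
  move=> /eqP; rewrite lebesgue_measure_itv/= lte_fin ltr01.
  by rewrite oppr0 addr0 onee_eq0.
have ltgl : cvg (g s @[s --> t^'-]).
  apply: nondecreasing_at_left_is_cvgr.
    by near=> s => u v _ _; exact: ndg.
  near=> s; exists (g t) => _ [u /= + <-]; rewrite in_itv/=.
  by move=> /andP[_ /ltW]; exact: ndg.
have ltgr : cvg (g s @[s --> t^'+]).
  apply: nondecreasing_at_right_is_cvgr.
    by near=> s => u v _ _; exact: ndg.
  near=> s; exists (g t) => _ [u /= + <-]; rewrite in_itv/=.
  by move=> /andP[/ltW + _]; exact: ndg.
exists t => // e e0.
have eqlr : lim (g s @[s --> t^'-]) = lim (g s @[s --> t^'+]).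
  by apply: contrapT => /eqP neq; apply: ncont; split; [exact: t01|split].
have gtl : (lim (g s @[s --> t^'-]) <= g t)%R.
  apply: limr_le => //; near=> s; apply: ndg; apply/ltW.
  by near: s; exact: nbhs_left_lt.
have : \forall s \near t^'+, (g s < g t + e)%R.
  have : (lim (g s @[s --> t^'+]) < g t + e)%R.
    by rewrite -eqlr (le_lt_trans gtl)// ltrDl.
  by move=> /(cvgr_lt _ ltgr).
move=> H; near (t^'+)%R => s; exists s; last by near: s.
by near: s; exact: nbhs_right_gt.
Unshelve. all: by end_near. Qed.

Section null_rim.
Variables (R : realType) (E : topologicalType).
Variable P : probability (borel_fell E) R.
Implicit Types (K : set E).

(** Compact sets [K] that a [P]-random closed set almost surely does not touch
    without meeting the interior of [K]. *)
Definition null_rim K :=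
  compact K /\ P (hitting K `\` hitting (interior K)) = 0.

Let measurable_rim K : compact K ->
  measurable (hitting K `\` hitting (interior K) : set (borel_fell E)).
Proof.
move=> cK; apply: (@measurableD _ (borel_fell E)).
  exact: measurable_hitting.
by apply: measurable_hitting_open; exact: open_interior.
Qed.

Lemma null_rim_boundary K : null_rim K -> P (fell_boundary (hitting K)) = 0.
Proof.
move=> [cK K0]; apply: (@subset_measure0 _ (borel_fell E) _ P _ _ _ _
  (fell_boundary_hitting cK) K0).
  exact: measurable_fell_boundary.
exact: measurable_rim.
Qed.

Lemma null_rim0 : null_rim set0.
Proof.
split; first exact: compact0.
by rewrite interior0 setDv measure0.
Qed.

Lemma null_rimU K L : null_rim K -> null_rim L -> null_rim (K `|` L).
Proof.
move=> [cK K0] [cL L0]; have cKL := compactU cK cL; split => //.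
apply: (@subset_measure0 _ (borel_fell E) _ P _
    ((hitting K `\` hitting (interior K)) `|`
     (hitting L `\` hitting (interior L)) : set (borel_fell E))).
- exact: measurable_rim.
- by apply: (@measurableU _ (borel_fell E)); exact: measurable_rim.
- rewrite hittingU => F [[FK|FL] nF]; [left|right]; split => // FI; apply: nF.
  + by apply: hittingS FI; apply: interiorS; exact: subsetUl.
  + by apply: hittingS FI; apply: interiorS; exact: subsetUr.
- by apply: null_set_setU => //; exact: measurable_rim.
Qed.

(** The rims of the sublevel sets [f <= t] are pairwise disjoint, so that all
    but countably many of them are null. The level [t] is a continuity point of
    the nondecreasing function [s |-> P (hitting [f < s])]: the sets
    [hitting [f <= t]] and [hitting [f < t]] then have the same probability. *)
Lemma null_rim_sublevel (f : E -> R) : continuous f ->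
  (forall t : R, (t < 1)%R -> compact [set x | (f x <= t)%R]) ->
  exists2 t : R, (0 < t < 1)%R & null_rim [set x | (f x <= t)%R].
Proof.
move=> cf fK.
pose lt t := [set x | (f x < t)%R]; pose le t := [set x | (f x <= t)%R].
have olt t : open (lt t).
  exact: ((continuousP _).1 cf [set y | (y < t)%R] (@open_lt _ t)).
have mlt t : measurable (hitting (lt t) : set (borel_fell E)).
  exact: measurable_hitting_open.
pose g (t : R) := fine (P (hitting (lt t))).
have gE t : P (hitting (lt t)) = (g t)%:E by rewrite fineK// fin_num_measure.
have ndg : {homo g : s t / (s <= t)%R}.
  move=> s t st; rewrite -lee_fin -!gE; apply: le_measure; rewrite ?inE//.
  by apply: hittingS => x /= /lt_le_trans; apply.
have [t t01 gt] := nondecreasing_continuity_point ndg.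
exists t => //; have ct : compact (le t) by apply: fK; case/andP: t01.
have mt : measurable (hitting (le t) : set (borel_fell E)).
  exact: measurable_hitting.
split => //.
have Ple : P (hitting (le t)) <= P (hitting (lt t)).
  apply/lee_addgt0Pr => e /gt[s ts gs].
  apply: (@Order.POrderTheory.le_trans _ _ (P (hitting (lt s)))).
    apply: le_measure; rewrite ?inE//.
    by apply: hittingS => x /= /le_lt_trans; exact.
  by rewrite !gE -EFinD lee_fin ltW.
apply: (@subset_measure0 _ (borel_fell E) _ P _
    (hitting (le t) `\` hitting (lt t) : set (borel_fell E))).
- exact: measurable_rim.
- exact: (@measurableD _ (borel_fell E)).
- apply: setDS; apply: hittingS; rewrite -open_subsetE//.
  by move=> x /= /ltW.
- have ltle : hitting (lt t) `<=` hitting (le t).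
    by apply: hittingS => x /= /ltW.
  have mD := @measurableD _ (borel_fell E) _ _ mt (mlt t).
  apply/eqP; rewrite eq_le measure_ge0 andbT.
  move: Ple; rewrite -[in P (hitting (le t))](setDUK ltle).
  rewrite measureU//; last by rewrite setDIK.
  move=> Pge; rewrite -(@leeD2lE _ (P (hitting (lt t)))) ?adde0//.
  exact: fin_num_measure.
Qed.

Hypothesis E_locally_compact : locally_compact [set: E].
Hypothesis E_hausdorff : hausdorff_space E.

Lemma null_rim_nbhs (x : E) (U : set E) : open U -> U x ->
  exists K, [/\ null_rim K, interior K x & K `<=` U].
Proof.
move=> oU Ux; have [C] := E_locally_compact (I : [set: E] x).
rewrite withinET => Cx [cC clC].
pose V := interior C `&` U.
have oV : open V by apply: openI => //; exact: open_interior.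
have /(@uniform_separatorP _ R)[f [cf _ f0 f1]] :
    uniform_separator [set x] (~` V).
  apply: (@locally_compact_completely_regular E R) => //.
    by rewrite closedC.
  by apply; split.
have fV (t : R) : (t < 1)%R -> [set x | (f x <= t)%R] `<=` V.
  move=> t1 y /= fy; apply: contrapT => nVy.
  have : f y = 1%R by apply: f1; exists y.
  by move=> fy1; move: fy; rewrite fy1 leNgt t1.
have [|t t01 Kt] := null_rim_sublevel cf.
  move=> t t1; apply: (subclosed_compact _ cC).
    exact: ((continuous_closedP _).1 cf [set y | (y <= t)%R] (@closed_le _ t)).
  by move=> y /(fV _ t1)[/interior_subset].
have [t0 t1] := andP t01.
exists [set x | (f x <= t)%R]; split => //; last by move=> y /(fV _ t1)[].
have sub : [set x | (f x < t)%R] `<=` [set x | (f x <= t)%R].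
  by move=> y /= /ltW.
have olt : open [set x | (f x < t)%R].
  exact: ((continuousP _).1 cf [set y | (y < t)%R] (@open_lt _ t)).
move: sub; rewrite open_subsetE// => /(_ x); apply => /=.
by have -> : f x = 0%R by apply: f0; exists x.
Qed.

End null_rim.

(** * Countable bases of compact sets with a null rim *)

Section null_rim_countable.
Variables (R : realType) (E : topologicalType).
Variable P : probability (borel_fell E) R.
Hypothesis E_locally_compact : locally_compact [set: E].
Hypothesis E_hausdorff : hausdorff_space E.

(** For each pair of members [V], [W] of a countable base, choose one compact
    set with a null rim between [V] and [W], if there is any. *)
Lemma null_rim_countable_basis : @second_countable E ->
  exists D : nat -> set E, (forall n, null_rim P (D n)) /\
    forall x U, open U -> U x -> exists2 n, interior (D n) x & D n `<=` U.
Proof.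
move=> [B /countable_injP[f finj] [Bo Bnbhs]].
(* The pair [(V, W)] is coded by the natural number [n]. *)
pose between n := [set K : set E | null_rim P K /\ exists V W,
  [/\ B V, B W, n = choice.pickle (f V, f W), V `<=` K & K `<=` W]].
exists (fun n => xget set0 (between n)); split.
  by move=> n; case: xgetP => [K _ []//|_]; exact: null_rim0.
move=> x U oU Ux.
have [W [BW Wx] WU] : filter_from [set W | B W /\ W x] id U.
  by apply: Bnbhs; apply: open_nbhs_nbhs.
have [K [K0 Kx KW]] :=
  null_rim_nbhs P E_locally_compact E_hausdorff (Bo _ BW) Wx.
have [V [BV Vx] VK] : filter_from [set V | B V /\ V x] id (interior K).
  by apply: Bnbhs; apply: open_nbhs_nbhs; split => //; exact: open_interior.
set n := choice.pickle (f V, f W).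
have : between n (xget set0 (between n)).
  apply: xgetPex; exists K; split => //; exists V, W; split => //.
  by apply: subset_trans VK _; exact: interior_subset.
move=> [_ [V' [W' [BV' BW' + VL LW]]]].
move=> /(pcan_inj choice.pickleK)[/finj + /finj]; rewrite !inE.
move=> /(_ BV BV') VV' /(_ BW BW') WW'; exists n.
  by move: VL; rewrite -VV' open_subsetE; [apply|exact: Bo].
by apply: subset_trans WU; rewrite WW'.
Qed.

(** There are countably many finite unions [L] of members of the family given by
    [null_rim_countable_basis], and the sets [missing L] form a base of the
    upper Fell topology. The case [O = setT] is excluded to keep each
    [K n] non-empty, as [missing set0 = setT]. *)
Lemma upper_fell_open_null_rim (O : set (closed_sets E)) :
  @second_countable E -> upper_fell_open O -> O !=set0 -> O != setT ->
  exists K : nat -> set E,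
    (forall n, null_rim P (K n) /\ K n !=set0) /\ O = \bigcup_n missing (K n).
Proof.
move=> /null_rim_countable_basis[D [D0 Dbase]] oO [F0 OF0] OT.
pose DU (s : seq nat) := \big[setU/set0]_(i <- s) D i.
have DU0 s : null_rim P (DU s).
  rewrite /DU; elim/big_ind: _ => //; first exact: null_rim0.
  exact: null_rimU.
have DUO F : O F -> exists s, missing (DU s) F /\ missing (DU s) `<=` O.
  move=> /(upper_fell_open_base oO)[K [cK KF KO]].
  (* [cov n] is the union of those among the first [n] sets of the family that
     do not meet [F]; these unions exhaust the complement of [F]. *)
  pose off i := `[< D i `<=` ~` val F >].
  pose cov n := DU [seq i <- iota 0 n | off i].
  have : \forall n \near \oo, K `<=` cov n.
    apply: ((compact_near_coveringP K).1 cK _ _ (fun n x => cov n x)) => x Kx.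
    have [||i Dix DiF] := Dbase x (~` val F).
    - by rewrite openC; exact: set_valP F.
    - by move=> Fx; have : (val F `&` K) x by []; rewrite KF.
    exists (interior (D i), [set n | (i < n)%N]) => /=.
      split; last by exists i.+1.
      by apply: open_nbhs_nbhs; split => //; exact: open_interior.
    move=> [y n] /= [Diy ni]; rewrite /cov /DU.
    rewrite -bigcup_seq; exists i; last exact: interior_subset Diy.
    rewrite /= mem_filter; apply/andP; split; last by rewrite mem_iota.
    by apply/asboolP => z; exact: DiF.
  move=> [n _ /(_ _ (leqnn n)) Kn]; exists [seq i <- iota 0 n | off i].
  split; last by apply: subset_trans KO; exact: missingS.
  rewrite -setC_hitting /DU -bigcup_seq hitting_bigcup => -[i + [x [Fx Dx]]].
  by rewrite /= mem_filter => /andP[/asboolP + _] => /(_ _ Dx).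
have [s0 [_ s0O]] := DUO _ OF0.
pose valid s := `[< missing (DU s) `<=` O >].
(* [e] enumerates the valid lists of indices, [s0] filling the gaps. *)
pose e n :=
  if choice.unpickle n is Some s then if valid s then s else s0 else s0.
have eO n : missing (DU (e n)) `<=` O.
  by rewrite /e; case: choice.unpickle => // s; case: ifP => // /asboolP.
exists (DU \o e); split => [n|].
  split; first exact: DU0.
  apply/set0P/negP => /eqP /= e0; move/eqP: OT; apply.
  apply/seteqP; split => // F _; apply: (eO n).
  by rewrite e0 /missing /= setI0.
apply/seteqP; split => F; last by move=> [n _]; exact: eO.
move=> /DUO[s [sF /asboolP sO]]; exists (choice.pickle s) => //=.
by rewrite /e choice.pickleK /valid sO.
Qed.

End null_rim_countable.

(** * Nets of probability measures *)

Section weak.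
Variables (d : measure_display) (T : measurableType d) (R : realType).
Variables (A : Type) (le : A -> A -> Prop) (le_directed : directed le).

Lemma tails_filter : Filter (tails le).
Proof.
have [[a0] refl trans dir] := le_directed.
apply: filter_from_filter; first by exists a0.
move=> a b _ _; have [c [ac bc]] := dir a b; exists c => // e ce.
by split; [exact: trans ac ce|exact: trans bc ce].
Qed.

(** Weak convergence means [P U <= liminf_a P_ a U] for all [U] in [O]. *)
Lemma weak_cvgP (P_ : A -> probability T R) (P : probability T R)
    (O : set_system T) : O `<=` measurable ->
  weak_cvg le P_ P O <->
  forall U, O U -> forall r : R, r%:E < P U ->
    exists a, forall b, le a b -> r%:E < P_ b U.
Proof.
move=> mO; have FF := tails_filter.
have fineE (Q : probability T R) U r : O U -> (r < fine (Q U))%R = (r%:E < Q U).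
  by move=> OU; rewrite -lte_fin fineK// fin_num_measure//; exact: mO.
split=> [/cvg_sup cvgP U OU r rU|H].
  have := cvgP (exist _ U OU) [set Q : probability T R | (r < fine (Q U))%R].
  case.
    exists [set Q : probability T R | (r < fine (Q U))%R]; split => //.
      exists [set x : lower_reals R | (r < x)%R] => //.
      by apply: Or33; exists r.
    by rewrite /= fineE.
  by move=> a _ Pa; exists a => b /Pa /=; rewrite fineE.
apply/cvg_sup => -[U OU] V [W [[L oL <-] LP] WV].
have [a Pa] : exists a, forall b, le a b -> L (fine (P_ b U)).
  case: oL LP => [->|->|[r ->]] /=.
  - by have [[a0] _ _ _] := le_directed => _; exists a0.
  - by [].
  - rewrite /eval_open fineE// => /H[]// a Ha; exists a => b /Ha.
    by rewrite fineE.
by exists a => // b /Pa Lb; exact: WV.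
Qed.
End weak.

Lemma net_limsup_lt (R : realType) (A : Type) (le : A -> A -> Prop)
    (x : A -> \bar R) (y : \bar R) :
  net_limsup le x < y -> exists a, forall b, le a b -> x b < y.
Proof.
move=> /ereal_inf_lt[_ [a _ <-] lty]; exists a => b ab.
by apply: le_lt_trans lty; apply: ereal_sup_ubound; exists b.
Qed.

Lemma net_limsup_le (R : realType) (A : Type) (le : A -> A -> Prop)
    (x : A -> \bar R) (y : \bar R) a :
  (forall b, le a b -> x b <= y) -> net_limsup le x <= y.
Proof.
move=> xy; apply: (@le_trans _ _ (ereal_sup [set x b | b in [set b | le a b]])).
  by apply: ereal_inf_lbound; exists a.
by apply: ge_ereal_sup => _ [b /xy + <-].
Qed.

(** * The equivalence *)

Lemma upper_fell_open_setC_bigcap_hitting (E : topologicalType) (m : nat)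
    (K : 'I_m -> set E) :
  (forall k, compact (K k)) -> upper_fell_open (~` \bigcap_k hitting (K k)).
Proof.
move=> cK; rewrite setC_bigcap; apply: (@bigcup_open (upper_fell E)) => k _.
by rewrite setC_hitting; exact: upper_fell_open_missing.
Qed.

Section equivalence.
Variables (R : realType) (E : topologicalType) (A : Type) (le : A -> A -> Prop).
Variables (P_ : A -> probability (borel_fell E) R).
Variable P : probability (borel_fell E) R.
Hypothesis le_directed : directed le.

Lemma weak_cvg_limsup_hitting : weak_cvg le P_ P (@upper_fell_open E) ->
  forall (m : nat) (K : 'I_m -> set E), (forall k, compact (K k)) ->
    net_limsup le (fun a => P_ a (\bigcap_k hitting (K k)))
      <= P (\bigcap_k hitting (K k)).
Proof.
move=> /(weak_cvgP le_directed _ _ (@measurable_upper_fell_open E)) PP m K cK.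
have oC := upper_fell_open_setC_bigcap_hitting cK.
set C := \bigcap_k hitting (K k).
have mC : measurable (C : set (borel_fell E)).
  rewrite -[C]setCK; apply: (@measurableC _ (borel_fell E)).
  exact: measurable_upper_fell_open.
have setCE (Q : probability (borel_fell E) R) :
    Q (~` C) = (1 - fine (Q C))%:E.
  by rewrite EFinB fineK ?fin_num_measure//; exact: probability_setC.
apply/lee_addgt0Pr => e e0.
have [|a Pa] := PP _ oC (1 - fine (P C) - e)%R.
  by rewrite setCE lte_fin ltrBlDr ltrDl.
apply: (@net_limsup_le _ _ _ _ _ a) => b /Pa.
rewrite setCE lte_fin => Pb.
rewrite -(fineK (fin_num_measure (P_ b) _ mC)).
rewrite -(fineK (fin_num_measure P _ mC)).
by rewrite -EFinD lee_fin; move: Pb; lra.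
Qed.

Lemma limsup_hitting_weak_cvg :
  locally_compact [set: E] -> @second_countable E -> hausdorff_space E ->
  (forall (m : nat) (K : 'I_m -> set E), (0 < m)%N ->
    (forall k, compact (K k) /\ K k !=set0) ->
    (forall k, P (fell_boundary (hitting (K k))) = 0) ->
    net_limsup le (fun a => P_ a (\bigcap_k hitting (K k)))
      <= P (\bigcap_k hitting (K k))) ->
  weak_cvg le P_ P (@upper_fell_open E).
Proof.
move=> Elc Esc Ehd PP.
apply/(weak_cvgP le_directed _ _ (@measurable_upper_fell_open E)) => U oU r rU.
have [[a0] le_refl _ _] := le_directed.
have [UT|UT] := eqVneq U setT.
  exists a0 => b _; move: rU; rewrite UT.
  by rewrite (probability_setT P) (probability_setT (P_ b)).
have [U0|/set0P U0] := eqVneq U set0.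
  exists a0 => b _; move: rU; rewrite U0.
  by rewrite (measure0 P) (measure0 (P_ b)).
have [K [K0 UE]] := upper_fell_open_null_rim P Elc Ehd Esc oU U0 UT.
have cK n : compact (K n) by have [[]] := K0 n.
pose V n : set (borel_fell E) :=
  \bigcup_(k in [set k | (k < n)%N]) missing (K k).
have VU n : V n `<=` U by rewrite UE => F [k _ Fk]; exists k.
have mV n : measurable (V n).
  apply: (@bigcup_measurable _ (borel_fell E)) => k _.
  exact: measurable_missing.
have UV : U = \bigcup_n V n.
  rewrite UE; apply/seteqP; split => F [n].
    by move=> _ Fn; exists n.+1 => //; exists n => /=.
  by move=> _ [k _ Fk]; exists k.
have mU : measurable (U : set (borel_fell E)).
  exact: measurable_upper_fell_open.
have VP : P (V n) @[n --> \oo] --> P U.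
  rewrite UV; apply: nondecreasing_cvg_mu => //; first by rewrite -UV.
  move=> n n' nn'; apply/subsetPset => F [k kn Fk]; exists k => //.
  exact: leq_trans kn nn'.
have [N _ rV] : \forall n \near \oo, r%:E < P (V n).
  apply: (VP [set x | r%:E < x]); apply: open_nbhs_nbhs; split => //.
  exact: open_ereal_gt_ereal.
have {}rV : r%:E < P (V N.+1) by exact: rV (leqnSn N).
(* The union is over [N.+1] indices since a positive number is required. *)
pose C := \bigcap_(k : 'I_N.+1) hitting (K k) : set (borel_fell E).
have VC : V N.+1 = ~` C.
  rewrite /C setC_bigcap; apply/seteqP; split => F [k].
    by move=> kN Fk; exists (Ordinal kN) => //; rewrite setC_hitting.
  by move=> _; rewrite setC_hitting => Fk; exists k => /=.
have mC : measurable C by rewrite -[C]setCK -VC; exact: measurableC.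
have VE (Q : probability (borel_fell E) R) : Q (V N.+1) = (1 - fine (Q C))%:E.
  by rewrite VC EFinB fineK ?fin_num_measure//; exact: probability_setC.
have PC : P C < (1 - r)%:E.
  rewrite -(fineK (fin_num_measure P _ mC)) lte_fin.
  by move: rV; rewrite VE lte_fin; lra.
have [|a Pa] := @net_limsup_lt R A le (fun a => P_ a C) (1 - r)%:E.
  apply: le_lt_trans PC; apply: PP => // k.
    by split; [exact: cK|case: (K0 k)].
  by apply: null_rim_boundary; case: (K0 k).
exists a => b /Pa PbC; apply: (@lt_le_trans _ _ (P_ b (V N.+1))).
  rewrite VE lte_fin; move: PbC.
  by rewrite -(fineK (fin_num_measure (P_ b) _ mC)) lte_fin; lra.
by apply: le_measure; rewrite ?inE.
Qed.

End equivalence.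

Theorem theorem2 (R : realType) (E : topologicalType)
    (E_nonempty : [set: E] !=set0)
    (E_locally_compact : locally_compact [set: E])
    (E_second_countable : @second_countable E)
    (E_hausdorff : hausdorff_space E)
    (A : Type) (le : A -> A -> Prop) (le_directed : directed le)
    (P_ : A -> probability (borel_fell E) R) (P : probability (borel_fell E) R) :
  let i := weak_cvg le P_ P (@upper_fell_open E) in
  let ii :=
    forall (m : nat) (K : 'I_m -> set E), (0 < m)%N ->
      (forall k, compact (K k) /\ K k !=set0) ->
      net_limsup le (fun a => P_ a (\bigcap_k hitting (K k)))
        <= P (\bigcap_k hitting (K k)) in
  let iii :=
    forall (m : nat) (K : 'I_m -> set E), (0 < m)%N ->
      (forall k, compact (K k) /\ K k !=set0) ->
      (forall k, P (fell_boundary (hitting (K k))) = 0) ->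
      net_limsup le (fun a => P_ a (\bigcap_k hitting (K k)))
        <= P (\bigcap_k hitting (K k)) in
  (i <-> ii) /\ (ii <-> iii).
Proof.
move=> i ii iii.
have i_ii : i -> ii.
  move=> iP m K _ cK; apply: weak_cvg_limsup_hitting => //.
  by move=> k; case: (cK k).
have ii_iii : ii -> iii by move=> iiP m K m0 cK _; exact: iiP.
have iii_i : iii -> i by exact: limsup_hitting_weak_cvg.
by split; split => //; [move=> /ii_iii/iii_i|move=> /iii_i/i_ii].
Qed.
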